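(* Let $L\subset\mathbb{P}^3$ be a line and let $C\subset\mathbb{P}^3$ be an irreducible curve. Suppose that $W=L\star C$ is a surface of degree $\deg(W)\ge 3$ and that the Hadamard map $h_{L,C}\colon L\times C\dashrightarrow L\star C$ is a morphism. Then the intersection $W\cap H_i$ is non-transversal for each $i=0,\dots,3$, where $H_i=\{x_i=0\}$. In particular, $W$ is not a cone.
   Context: Work over $\mathbb{C}$ with fixed homogeneous coordinates $x_0,\dots,x_3$ on $\mathbb{P}^3$. For points $p=(p_0:\cdots:p_3)$ and $q=(q_0:\cdots:q_3)$ the Hadamard product is $p\star q=(p_0q_0:\cdots:p_3q_3)$, defined whenever not all $p_iq_i$ vanish. For varieties $X,Y\subset\mathbb{P}^3$, $X\star Y$ is the Zariski closure of $\{p\star q : p\in X,\ q\in Y,\ p\star q \text{ is defined}\}$, and $h_{X,Y}\colon X\times Y\dashrightarrow X\star Y$ is the rational map $(p,q)\mapsto p\star q$. The intersection $W\cap H_i$ is transversal if at every point of $W\cap H_i$ the surface $W$ is smooth with tangent plane different from $H_i$ (equivalently, the scheme $W\cap H_i$ is a smooth plane curve); otherwise it is non-transversal. *)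

(* Defs.v *)
From mathcomp Require Import all_boot all_order all_algebra.
From mathcomp Require Import classical_sets reals.
From mathcomp.real_closed Require Import complex.
From mathcomp Require Import mpoly.
Set Implicit Arguments.
Unset Strict Implicit.
Unset Printing Implicit Defensive.
Import GRing.Theory.
Local Open Scope classical_set_scope.
Local Open Scope ring_scope.

(* A point of P^3 is given by a nonzero coordinate vector 'rV[K]_4, and a
   subset of P^3 by the set of all coordinate vectors of its points.  A set X
   obtained as the zero locus of forms, as a linear subspace, or as a Hadamard
   product of such sets contains only nonzero vectors and is invariant under
   nonzero scaling, so inclusion and equality of such sets are those of P^3. *)

Section ProjectiveSpace.
Variable K : fieldType.
Implicit Types (X Y : set 'rV[K]_4) (v w p q : 'rV[K]_4) (f g : {mpoly K[4]}).

Definition evalv n (f : {mpoly K[n]}) (v : 'rV[K]_n) : K := f.@[fun i => v 0 i].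

Definition same_point v w := exists2 c : K, c != 0 & v = c *: w.

Definition form f := exists d : nat, f \is d.-homog.

Definition zero_locus (S : set {mpoly K[4]}) : set 'rV[K]_4 :=
  [set v : 'rV[K]_4 | v != 0 /\ forall f, S f -> evalv f v = 0].

Definition vanishing_ideal X : set {mpoly K[4]} :=
  [set f | forall v, X v -> evalv f v = 0].

Definition zariski_closed X :=
  exists2 S : set {mpoly K[4]}, S `<=` form & X = zero_locus S.

Definition zariski_closure X : set 'rV[K]_4 :=
  zero_locus (form `&` vanishing_ideal X).

Definition irreducible_closed X :=
  [/\ zariski_closed X, X !=set0 &
      forall A B, zariski_closed A -> zariski_closed B ->
        X `<=` A `|` B -> X `<=` A \/ X `<=` B].

(* Krull dimension of the underlying topological space: the maximal length n
   of a chain Z 0 < ... < Z n of irreducible closed subsets. *)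
Definition has_chain X (n : nat) :=
  exists Z : nat -> set 'rV[K]_4,
    (forall i, (i <= n)%N -> irreducible_closed (Z i) /\ Z i `<=` X) /\
    (forall i, (i < n)%N -> Z i `<` Z i.+1).

Definition has_dim X (n : nat) := has_chain X n /\ ~ has_chain X n.+1.

Definition linear_subspace (n : nat) X :=
  exists2 U : {vspace 'rV[K]_4},
    \dim U = n.+1 & X = [set v : 'rV[K]_4 | v != 0 /\ v \in U].

Definition is_line X := linear_subspace 1 X.

Definition irreducible_curve X := irreducible_closed X /\ has_dim X 1.

Definition is_surface X := zariski_closed X /\ has_dim X 2.

(* The degree of a surface is the degree of its reduced equation, i.e. of a
   generator of its vanishing ideal. *)
Definition surface_degree X (d : nat) :=
  exists f : {mpoly K[4]},
    [/\ f != 0, f \is d.-homog &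
        forall g, vanishing_ideal X g <-> exists h, g = h * f].

Definition coord_plane (i : 'I_4) : set 'rV[K]_4 :=
  [set v : 'rV[K]_4 | v != 0 /\ v 0 i = 0].

(* The embedded projective tangent space to X at v. *)
Definition tangent_space X v : set 'rV[K]_4 :=
  [set w : 'rV[K]_4 | w != 0 /\ forall f, vanishing_ideal X f ->
     \sum_(j < 4) evalv (mderiv j f) v * w 0 j = 0].

Definition surface_smooth_at X v := linear_subspace 2 (tangent_space X v).

Definition meets_coord_plane_transversally X (i : 'I_4) :=
  forall v, (X `&` coord_plane i) v ->
    surface_smooth_at X v /\ tangent_space X v <> coord_plane i.

Definition is_cone X :=
  exists2 v, X v &
    forall w, X w -> forall a b : K, a *: v + b *: w != 0 ->
      X (a *: v + b *: w).

Definition hmul p q : 'rV[K]_4 := \row_i (p 0 i * q 0 i).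

Definition hadamard X Y : set 'rV[K]_4 :=
  zariski_closure
    [set v | exists p q, [/\ X p, Y q, hmul p q != 0 & v = hmul p q]].

(* The variables 0..3 of {mpoly K[4 + 4]} are the coordinates of the first
   factor of P^3 x P^3 and the variables 4..7 those of the second. *)
Definition bihomog (a b : nat) (f : {mpoly K[4 + 4]}) :=
  forall m, m \in msupp f ->
    (\sum_(i < 4) m (lshift 4 i))%N = a /\ (\sum_(i < 4) m (rshift 4 i))%N = b.

Definition eval2 (F : 'I_4 -> {mpoly K[4 + 4]}) p q : 'rV[K]_4 :=
  \row_i evalv (F i) (row_mx p q).

(* Regularity at (p, q) of the rational map (p, q) |-> hmul p q from X x Y to
   P^3: some tuple of forms of one common bidegree has no common zero at
   (p, q) and agrees with hmul wherever both are defined on X x Y. *)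
Definition hadamard_map_regular_at X Y p q :=
  exists (a b : nat) (F : 'I_4 -> {mpoly K[4 + 4]}),
    [/\ forall i, bihomog a b (F i),
        eval2 F p q != 0 &
        forall p' q', X p' -> Y q' -> hmul p' q' != 0 -> eval2 F p' q' != 0 ->
          same_point (eval2 F p' q') (hmul p' q')].

Definition hadamard_map_is_morphism X Y :=
  forall p q, X p -> Y q -> hadamard_map_regular_at X Y p q.

End ProjectiveSpace.

(* Main.v *)
Require Import Defs.
From mathcomp Require Import all_boot all_order all_algebra all_fingroup.
From mathcomp Require Import classical_sets reals boolp.
From mathcomp.real_closed Require Import complex.
From mathcomp Require Import mpoly.
(* [form] would otherwise be that of sesquilinear forms. *)
Import Defs.
Set Implicit Arguments.
Unset Strict Implicit.
Unset Printing Implicit Defensive.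
Import GRing.Theory Num.Theory.
Local Open Scope classical_set_scope.
Local Open Scope ring_scope.

(* If [p * q] were undefined for some [p] in [L] and [q] in [C], the supports of
   [p] and [q] would be disjoint, and the limits of the Hadamard map at [(p, q)]
   along [{p} x C] and along [L x {q}] would have disjoint supports too; so the
   map would not be regular there.  Hence [L * q] is a line in [W] for every [q]
   in [C], and it lies in [H_i] when [q] does.  Such a [q] exists because a
   projective curve meets every plane: a closed set that misses [H_i] has
   projections that miss the plane at infinity as well, down to a finite subset
   of a line.

   Let [f] be the equation of [W] and [l] a line in [W] and [H_i].  The
   derivative of [f] in a direction of [H_i] transversal to [l] restricts to a
   binary form of degree [d - 1 > 0] on [l]; at a zero of it the differential
   of [f] kills [H_i], so [W] is not transversal to [H_i].

   If [W] were a cone, choose [H_i] not containing the vertex.  The plane spanned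
   by the vertex and [l] lies in [W], which is irreducible of degree at least 2. *)

(** * Evaluation of forms along lines *)

(** In characteristic 0 the numbers 1, ..., [size P] are distinct and nonzero, and a nonzero [P] has
    fewer than [size P] roots. *)
Lemma poly_eq0_punctured (K : numDomainType) (P : {poly K}) :
  (forall t, t != 0 -> P.[t] = 0) -> P = 0.
Proof.
move=> h; apply/eqP; apply/negPn/negP => P0.
pose s := [seq (k.+1%:R : K) | k <- iota 0 (size P)].
have := max_poly_roots (rs := s) P0.
rewrite size_map size_iota ltnn => h'; apply/notF/h'.
- by apply/allP => _ /mapP[k _ ->]; apply/rootP/h; rewrite pnatr_eq0.
- by rewrite map_inj_uniq ?iota_uniq // => a b /eqP; rewrite eqr_nat => /eqP[].
Qed.

Section Evaluation.
Variables (K : fieldType) (n : nat).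
Implicit Types (f g : {mpoly K[n]}) (u v w : 'rV[K]_n).

Lemma evalvD f g v : evalv (f + g) v = evalv f v + evalv g v.
Proof. exact: mevalD. Qed.

Lemma evalvM f g v : evalv (f * g) v = evalv f v * evalv g v.
Proof. exact: mevalM. Qed.

Lemma evalvX i v : evalv 'X_i v = v 0 i.
Proof. exact: mevalXU. Qed.

Lemma evalv_sum (I : Type) (r : seq I) (P : pred I) (F : I -> {mpoly K[n]}) v :
  evalv (\sum_(i <- r | P i) F i) v = \sum_(i <- r | P i) evalv (F i) v.
Proof. exact: raddf_sum. Qed.

Lemma evalv_homogZ d f c v :
  f \is d.-homog -> evalv f (c *: v) = c ^+ d * evalv f v.
Proof.
move=> /dhomogP hf; rewrite /evalv !mevalE mulr_sumr.
rewrite [LHS]big_seq [RHS]big_seq; apply: eq_bigr => m /hf hm.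
rewrite mulrCA; congr (_ * _); rewrite -hm /= mdegE -prodrXr -big_split /=.
by apply: eq_bigr => i _; rewrite mxE exprMn.
Qed.

Lemma evalv_homog0 d f : (0 < d)%N -> f \is d.-homog -> evalv f 0 = 0.
Proof.
move=> d0 hf; rewrite -[X in evalv f X](scale0r (0 : 'rV_n)).
by rewrite (evalv_homogZ _ _ hf) expr0n gtn_eqF ?mul0r.
Qed.

Lemma mderiv_homog d f i : f \is d.-homog -> mderiv i f \is d.-1.-homog.
Proof.
move=> hf; apply/dhomogP => m; rewrite mcoeff_msupp mcoeff_mderiv => h.
apply/eqP; apply: contraNT h => h; apply/eqP.
rewrite (dhomog_nemf_coeff hf) ?mul0rn //= mdegD mdeg1 addn1.
by apply: contraNN h => /eqP <- /=.
Qed.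

Definition line_poly f u w : {poly K} :=
  mmap polyC (fun i => (u 0 i)%:P + w 0 i *: 'X) f.

Lemma line_polyE f u w t : (line_poly f u w).[t] = evalv f (u + t *: w).
Proof.
rewrite /line_poly /evalv mevalE horner_sum; apply: eq_bigr => m _.
rewrite hornerM hornerC horner_prod; congr (_ * _); apply: eq_bigr => i _.
by rewrite horner_exp !hornerE !mxE mulrC.
Qed.

(** The chain rule. The identity [D] passes to sums and products and holds for constants and
    variables, so induction over monomials suffices. *)
Lemma deriv_line_poly f u w :
  (line_poly f u w)^`() = \sum_i w 0 i *: line_poly (mderiv i f) u w.
Proof.
pose D f := (line_poly f u w)^`() = \sum_i w 0 i *: line_poly (mderiv i f) u w.
have lM g h : line_poly (g * h) u w = line_poly g u w * line_poly h u w.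
  exact: rmorphM.
have lD g h : line_poly (g + h) u w = line_poly g u w + line_poly h u w.
  exact: rmorphD.
have lC c : line_poly c%:MP u w = c%:P by exact: mmapC.
have DM g h : D g -> D h -> D (g * h).
  rewrite /D lM derivM => -> ->; rewrite mulr_suml mulr_sumr -big_split /=.
  apply: eq_bigr => i _; rewrite mderivM lD !lM scalerDr.
  by rewrite scalerAl -scalerAr.
have DC c : D c%:MP.
  rewrite /D lC derivC big1 // => i _.
  by rewrite mderivC -[0 : mpoly _ _]/(0%:MP) lC scaler0.
have DX i : D 'X_i.
  rewrite /D {1}/line_poly mmapX mmap1U derivD derivC add0r derivZ derivX.
  rewrite (bigD1 i) //= big1 ?addr0 => [|j ij].
    rewrite mderivX mnm1E eqxx scale1r.
    have -> : (U_(i) - U_(i))%MM = 0%MM :> 'X_{1..n}.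
      by apply/mnmP => j; rewrite mnmBE subnn mnm0E.
    by by rewrite mpolyX0 -[1 : mpoly _ _]/(1%:MP) lC.
  rewrite mderivX mnm1E eq_sym (negbTE ij) scale0r.
  by rewrite -[0 : mpoly _ _]/(0%:MP) lC scaler0.
have D0 : D 0 by exact: DC 0.
have D1 : D 1 by exact: DC 1.
elim/mpolyind: f => [|c m f _ _ Df]; first exact: D0.
rewrite lD derivD Df; have : D (c *: 'X_[m]).
  rewrite -mul_mpolyC; apply: (DM); first exact: DC.
  rewrite mpolyXE_id; apply: (big_ind D D1 DM) => i _.
  elim: (m i) => [|k IH]; first by rewrite expr0.
  by rewrite exprS; apply: DM.
rewrite /D => ->; rewrite -big_split /=; apply: eq_bigr => i _.
by rewrite mderivD lD scalerDr.
Qed.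

End Evaluation.

Section NumClosed.
Variables (K : numClosedFieldType).

Lemma evalv_line_punctured n (f : {mpoly K[n]}) u w :
  (forall t, t != 0 -> evalv f (u + t *: w) = 0) -> line_poly f u w = 0.
Proof.
by move=> h; apply: poly_eq0_punctured => t t0; rewrite line_polyE h.
Qed.

(** The algebraic substitute for letting [t] tend to 0. *)
Lemma evalv_limit n (f : {mpoly K[n]}) u w :
  (forall t, t != 0 -> evalv f (u + t *: w) = 0) -> evalv f u = 0.
Proof.
move=> /evalv_line_punctured h.
by have := line_polyE f u w 0; rewrite h horner0 scale0r addr0.
Qed.

Lemma directional_deriv0 n (f : {mpoly K[n]}) u w :
  (forall t, evalv f (u + t *: w) = 0) ->
  \sum_j evalv (mderiv j f) u * w 0 j = 0.
Proof.
move=> h; have l0 : line_poly f u w = 0.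
  by apply: evalv_line_punctured => t _.
have := congr1 (horner^~ 0) (deriv_line_poly f u w).
rewrite l0 deriv0 horner0 horner_sum => {2}->; apply: eq_bigr => j _.
by rewrite hornerZ line_polyE scale0r addr0 mulrC.
Qed.

(** For [v] in [X] the value of [f] at [t *: v] is a polynomial in [t], with the values at [v] of
    the homogeneous components of [f] as coefficients. It vanishes for [t != 0], so all components
    vanish on [X]; one of them is nonzero at [a]. *)
Lemma homog_component n (X : set 'rV[K]_n) (f : {mpoly K[n]}) a :
  (forall v c, X v -> c != 0 -> X (c *: v)) ->
  (forall v, X v -> evalv f v = 0) -> evalv f a != 0 ->
  exists d g, [/\ g \is d.-homog, forall v, X v -> evalv g v = 0
                & evalv g a != 0].
Proof.
move=> Xcone fX fa.
have fE := pihomog_partitionE (mf := mdeg) (leqnn (mmeasure mdeg f)).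
set N := mmeasure mdeg f in fE.
have [i gi] : exists i : 'I_N, evalv (pihomog mdeg i f) a != 0.
  apply/existsP; apply: contraNT fa => /existsPn h.
  rewrite fE evalv_sum big1 // => i _; apply/eqP; have := h i.
  by rewrite negbK.
exists i, (pihomog mdeg i f); split=> // [|v Xv]; first exact: pihomogP.
pose P := \poly_(k < N) evalv (pihomog mdeg k f) v.
suff P0 : P = 0.
  by have := congr1 (fun Q : {poly K} => Q`_i) P0; rewrite coef_poly ltn_ord coef0.
apply: poly_eq0_punctured => t t0; rewrite horner_poly.
transitivity (evalv f (t *: v)); last by apply/fX/Xcone.
symmetry.
rewrite {1}fE evalv_sum; apply: eq_bigr => k _.
by rewrite (evalv_homogZ _ _ (pihomogP mdeg k f)) mulrC.
Qed.

End NumClosed.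

(** * Elimination of a variable *)

(** The shape of the Sylvester matrix depends on the two degrees, which [phi] preserves when it
    keeps the leading coefficients nonzero. *)
Lemma resultant_specialize (A B : comNzRingType) (phi : {rmorphism A -> B})
    (p q : {poly A}) :
  phi (lead_coef p) != 0 -> phi (lead_coef q) != 0 ->
  phi (resultant p q) = resultant (map_poly phi p) (map_poly phi q).
Proof.
move=> p0 q0; rewrite /resultant -det_map_mx /Sylvester_mx.
rewrite !size_map_poly_id0 // map_col_mx.
congr (\det (col_mx _ _)); apply: map_lin1_mx => v;
  by rewrite map_poly_rV rmorphM /= map_rVpoly.
Qed.

(** A resultant lies in the ideal of its two polynomials, so [psi] kills it if they acquire a common
    root; over a closed field it is nonzero when there is none. *)
Lemma eliminate_variable (A : idomainType) (K : closedFieldType)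
    (phi : {rmorphism A -> K}) (f g : {poly A}) :
  phi (lead_coef g) != 0 ->
  (forall x, root (map_poly phi g) x -> ~~ root (map_poly phi f) x) ->
  exists2 r, forall (psi : {rmorphism A -> K}) x,
      root (map_poly psi f) x -> root (map_poly psi g) x -> psi r = 0
    & phi r != 0.
Proof.
move=> g0 sep; have [g1|g1] := leqP (size g) 1.
  exists (lead_coef g) => // psi x _.
  by rewrite (size1_polyC g1) lead_coefC map_polyC => /rootP; rewrite hornerC.
(* Adding a large multiple of [g] makes the degree of [f] stable under [phi]
   and keeps its values at the roots of [g]. *)
pose h := f + g * 'X^(size f).
have gn0 : g != 0 by rewrite -size_poly_gt0 (leq_trans _ g1).
have ltfh : (size f < size (g * 'X^(size f))%R)%N.
  by rewrite size_mulXn // -[X in (X < _)%N]addn0 ltn_add2l size_poly_gt0.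
have h0 : lead_coef h = lead_coef g.
  by rewrite lead_coefDr // lead_coefM lead_coefXn mulr1.
have h1 : (1 < size h)%N.
  rewrite /h addrC size_polyDl // size_mulXn //; exact: leq_trans g1 (leq_addl _ _).
have [[u v] _ /= E] := resultant_in_ideal h1 g1.
exists (resultant h g) => [psi x /rootP fx /rootP gx|].
  have := congr1 (fun p => (map_poly psi p).[x]) E.
  rewrite map_polyC hornerC => ->.
  by rewrite !(rmorphD, rmorphM) !(hornerD, hornerM) fx gx !(mul0r, mulr0, addr0).
rewrite resultant_specialize ?h0 // resultant_eq0 -leqNgt.
rewrite leqNgt; apply/negP => gcd1.
have /closed_rootP[x] : size (gcdp (map_poly phi h) (map_poly phi g)) != 1%N.
  by rewrite gtn_eqF.
rewrite root_gcd => /andP[rh rg]; move/sep/negP: (rg); apply.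
move: rh; rewrite /root rmorphD rmorphM hornerD hornerM.
by rewrite (rootP rg) mul0r addr0.
Qed.

Section Elimination.
Variable K : numClosedFieldType.

Definition drop_last n (v : 'rV[K]_n.+1) : 'rV[K]_n :=
  \row_i v 0 (widen_ord (leqnSn n) i).

Definition append n (a : 'rV[K]_n) (t : K) : 'rV[K]_n.+1 :=
  \row_i if unlift ord_max i is Some j then a 0 j else t.

Lemma append_widen n (a : 'rV[K]_n) t i :
  append a t 0 (widen_ord (leqnSn n) i) = a 0 i.
Proof.
rewrite mxE (_ : widen_ord _ i = lift ord_max i) ?liftK //.
by apply: val_inj; rewrite /= /bump leqNgt ltn_ord.
Qed.

Lemma append_max n (a : 'rV[K]_n) t : append a t 0 ord_max = t.
Proof. by rewrite mxE unlift_none. Qed.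

Lemma drop_last_append n (a : 'rV[K]_n) t : drop_last (append a t) = a.
Proof. by apply/rowP => i; rewrite mxE append_widen. Qed.

Lemma evalv_muni n (f : {mpoly K[n.+1]}) v :
  evalv f v =
  (map_poly (meval (fun i => drop_last v 0 i)) (muni f)).[v 0 ord_max].
Proof.
rewrite muniE rmorph_sum horner_sum /evalv mevalE; apply: eq_bigr => m _.
rewrite -!mul_polyC !rmorphM /= map_polyXn !map_polyC /= !hornerE /=.
rewrite mevalZ mevalX big_ord_recr /= mulrA; congr (_ * _ * _).
by apply: eq_bigr => i _; rewrite mnmE mxE.
Qed.

Lemma evalv_append n (f : {mpoly K[n.+1]}) a t :
  evalv f (append a t) = (map_poly (meval (fun i => a 0 i)) (muni f)).[t].
Proof. by rewrite evalv_muni append_max drop_last_append. Qed.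

(** By homogeneity the [d]-th power of the last variable has a constant coefficient, and this is the
    value of [g] at [append 0 1]. *)
Lemma lead_coef_muni n d (g : {mpoly K[n.+1]}) :
  g \is d.-homog -> evalv g (append 0 1) != 0 ->
  exists2 c : K, c != 0 & lead_coef (muni g) = c%:MP.
Proof.
move=> hg ge.
have m_le m : m \in msupp g -> (m ord_max <= d)%N.
  by move=> /(dhomog_mf hg) /= <-; rewrite mdegE big_ord_recr leq_addl.
have sz : (size (muni g) <= d.+1)%N.
  rewrite muniE; apply: (leq_trans (size_sum _ _ _)).
  rewrite big_seq; elim/big_ind: _ => // [x y hx hy|m /m_le hm].
    by rewrite geq_max hx.
  by rewrite (leq_trans (size_scale_leq _ _)) // size_polyXn.
have [c cE] : exists c : K, (muni g)`_d = c%:MP.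
  exists (\sum_(m <- msupp g | m ord_max == d) g@_m).
  rewrite muniE coef_sum raddf_sum [RHS]big_mkcond /= big_seq [RHS]big_seq.
  apply: eq_bigr => m mg; rewrite coefZ coefXn eq_sym.
  have [md|_] := eqVneq; last by rewrite mulr0.
  rewrite mulr1 (_ : [multinom _ | i < n] = 0%MM) ?mpolyX0 ?alg_mpolyC //.
  apply/mnmP => i; rewrite mnmE mnm0E.
  have := dhomog_mf hg mg; rewrite /= mdegE big_ord_recr /= md.
  move=> /eqP; rewrite -[X in _ == X]add0n eqn_add2r sum_nat_eq0.
  by move=> /forallP/(_ i)/eqP.
have c0 : c = evalv g (append 0 1).
  pose P := map_poly (meval (fun i => (0 : 'rV[K]_n) 0 i)) (muni g).
  have PE : P = evalv g (append 0 1) *: 'X^d.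
    apply/eqP; rewrite -subr_eq0; apply/eqP/poly_eq0_punctured => t t0.
    rewrite hornerD hornerN hornerZ hornerXn -evalv_append.
    rewrite (_ : append 0 t = t *: append 0 1).
      by rewrite (evalv_homogZ _ _ hg) mulrC subrr.
    by apply/rowP => i; rewrite !mxE; case: unlift => [j|]; rewrite ?mxE ?mulr0 ?mulr1.
  have := congr1 (fun Q : {poly K} => Q`_d) PE.
  by rewrite coef_map cE /= mevalC coefZ coefXn eqxx mulr1.
exists c; first by rewrite c0.
rewrite lead_coefE (_ : size _ = d.+1) //; apply/eqP; rewrite eqn_leq sz ltnNge.
apply: contraNN ge => /leq_sizeP/(_ d (leqnn d)); rewrite cE => /eqP.
by rewrite mpolyC_eq0 c0.
Qed.

(** The plane at infinity is the zero locus of the first coordinate. Asking for equations, and not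
    merely for disjointness, gives a property that can be projected before the image is known to be
    closed. *)
Definition separated_from_infinity n (X : set 'rV[K]_n.+1) :=
  forall a : 'rV[K]_n.+1, a != 0 -> a 0 ord0 = 0 ->
  exists d g, [/\ g \is d.-homog, forall v, X v -> evalv g v = 0
                & evalv g a != 0].

(* Projection from the point [append 0 1] at infinity, which is not in [X]: for
   [a] at infinity no point [append a t] is in [X], so some resultant of
   equations of [X] does not vanish at [a]. *)
Lemma separated_drop_last n (X : set 'rV[K]_n.+2) :
  (forall v c, X v -> c != 0 -> X (c *: v)) ->
  separated_from_infinity X ->
  separated_from_infinity [set drop_last v | v in X].
Proof.
move=> Xcone sepX a a0 a00.
have widen0 : widen_ord (leqnSn n.+1) ord0 = ord0 by apply: val_inj.
have inf (b : 'rV[K]_n.+1) t : b 0 ord0 = 0 -> append b t 0 ord0 = 0.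
  by move=> b0; rewrite -[X in append b t 0 X]widen0 append_widen.
have [d [g [hg gX ge]]] : exists d g,
    [/\ g \is d.-homog, forall v, X v -> evalv g v = 0
      & evalv g (append 0 1) != 0].
  apply: sepX; last by apply: inf; rewrite mxE.
  apply/eqP => /rowP/(_ ord_max)/eqP.
  by rewrite append_max mxE oner_eq0.
have [c c0 lc] := lead_coef_muni hg ge.
have apX t : exists2 f : {mpoly K[n.+2]},
    forall v, X v -> evalv f v = 0 & evalv f (append a t) != 0.
  have [||e [f [_ fX fa]]] := sepX (append a t); last by exists f.
  - by apply: contraNneq a0 => /(congr1 (@drop_last _)); rewrite drop_last_append
      => ->; apply/eqP/rowP => i; rewrite !mxE.
  - exact: inf.
(* One equation of [X] must avoid finitely many points of the fibre over [a] at once; equations are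
   combined by interpolation. *)
have apXs (s : seq K) : exists2 f : {mpoly K[n.+2]},
    forall v, X v -> evalv f v = 0
    & forall t, t \in s -> evalv f (append a t) != 0.
  elim: s => [|t s [f fX fs]].
    by exists 0 => // v _; rewrite /evalv meval0.
  have [ts|ts] := boolP (t \in s).
    by exists f => // x; rewrite inE => /predU1P[->|]; apply: fs.
  have [h hX ht] := apX t.
  pose lin y : {mpoly K[n.+2]} := 'X_ord_max - y%:MP.
  have linE y z : evalv (lin y) (append a z) = z - y.
    by rewrite /evalv mevalB mevalXU mevalC append_max.
  have prodE z :
      evalv (\prod_(y <- s) lin y) (append a z) = \prod_(y <- s) (z - y).
    rewrite [LHS]rmorph_prod; apply: eq_bigr => y _; exact: linE.
  (* At [append a t] only the second term survives, at the points given by [s] only the first. *)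
  exists (f * lin t + h * \prod_(y <- s) lin y) => [v Xv|z].
    by rewrite evalvD !evalvM fX // hX // !mul0r addr0.
  rewrite inE evalvD !evalvM linE prodE => /predU1P[->|zs].
    rewrite subrr mulr0 add0r mulf_neq0 // prodf_seq_neq0.
    by apply/allP => y ys /=; rewrite subr_eq0; apply: contraNneq ts => ->.
  rewrite (big_rem z) //= subrr mul0r mulr0 addr0 mulf_neq0 ?fs // subr_eq0.
  by apply: contraNneq ts => <-.
pose phi := meval (fun i => a 0 i).
(* Here [s] lists the zeros of [g] on the fibre over [a], so [f] and [g] have no common zero
   there. *)
have [s sE] := closed_field_poly_normal (map_poly phi (muni g)).
have [f fX fs] := apXs s.
have lcg : phi (lead_coef (muni g)) != 0 by rewrite lc /phi mevalC.
have [x|r rX ra] := @eliminate_variable _ _ phi (muni f) _ lcg.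
  rewrite {1}sE rootZ; last by rewrite lead_coef_map_eq.
  by rewrite root_prod_XsubC => /fs; rewrite evalv_append.
apply: (homog_component (f := r)) => //.
- move=> _ b [w Xw <-] b0; exists (b *: w); first exact: Xcone.
  by apply/rowP => i; rewrite !mxE.
- move=> _ [w Xw <-].
  by apply: (rX _ (w 0 ord_max)); apply/rootP; rewrite -evalv_muni ?fX ?gX.
Qed.

End Elimination.

(** * A projective curve meets every coordinate plane *)

Section Substitution.
Variables (K : fieldType) (n : nat).
Implicit Types (f : {mpoly K[n]}) (a v : 'rV[K]_n) (M : 'M[K]_n).

Definition linform a : {mpoly K[n]} := \sum_j a 0 j *: 'X_j.

Lemma evalv_linform a v : evalv (linform a) v = \sum_j a 0 j * v 0 j.
Proof.
rewrite evalv_sum; apply: eq_bigr => j _.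
by rewrite /evalv mevalZ mevalXU.
Qed.

Lemma linform_homog a : linform a \is 1.-homog.
Proof. by apply: rpred_sum => j _; apply: rpredZ; rewrite dhomogX /= mdeg1. Qed.

Definition subst M f : {mpoly K[n]} :=
  f \mPo [tuple linform (col j M)^T | j < n].

Lemma evalv_subst M f v : evalv (subst M f) v = evalv f (v *m M).
Proof.
rewrite /evalv /subst comp_mpoly_meval; apply: meval_eq => j.
rewrite tnth_mktuple -[LHS]/(evalv _ _) evalv_linform mxE.
by apply: eq_bigr => k _; rewrite !mxE mulrC.
Qed.

Lemma subst_homog M d f : f \is d.-homog -> subst M f \is d.-homog.
Proof.
move=> hf; rewrite /subst comp_mpolyEX big_seq; apply: rpred_sum => m mf.
apply: rpredZ; rewrite comp_mpolyX -(dhomog_mf hf mf) /= mdegE.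
elim/big_ind2: _ => [|p k q l|j _]; [exact: dhomog1|exact: dhomogM|].
by rewrite tnth_mktuple; have := dhomogMn (m j) (linform_homog (col j M)^T);
  rewrite mul1n.
Qed.

End Substitution.

Section Closed.
Variable K : fieldType.
Implicit Types (X : set 'rV[K]_4) (f g : {mpoly K[4]}) (v : 'rV[K]_4).

Lemma zariski_closed_scale X v c :
  zariski_closed X -> X v -> c != 0 -> X (c *: v).
Proof.
move=> [S Sform ->] [v0 Sv] c0; split; first by rewrite scaler_eq0 negb_or c0.
move=> f Sf; have [d hf] := Sform f Sf.
by rewrite (evalv_homogZ _ _ hf) Sv // mulr0.
Qed.

Lemma zariski_closed_neq0 X v : zariski_closed X -> X v -> v != 0.
Proof. by move=> [S _ ->] []. Qed.

Lemma form_mul f g : form f -> form g -> form (f * g)%R.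
Proof. by case=> [d hf] [e hg]; exists (d + e)%N; apply: dhomogM. Qed.

Lemma form_X i : form ('X_i : {mpoly K[4]}).
Proof. by exists 1%N; rewrite dhomogX /= mdeg1. Qed.

(** The zero loci of [f] and [g] are closed and cover [X]. *)
Lemma irreducible_closed_prime X f g :
  irreducible_closed X -> form f -> form g ->
  (forall v, X v -> evalv f v * evalv g v = 0) ->
  (forall v, X v -> evalv f v = 0) \/ (forall v, X v -> evalv g v = 0).
Proof.
move=> [Xc _ Xirr] hf hg fg0.
have cl h : form h -> zariski_closed (zero_locus [set h]).
  by move=> hh; exists [set h] => // _ ->.
have [||v Xv|Xf|Xg] := Xirr (zero_locus [set f]) (zero_locus [set g]).
- exact: cl.
- exact: cl.
- have v0 := zariski_closed_neq0 Xc Xv.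
  have /eqP := fg0 v Xv; rewrite mulf_eq0 => /orP[/eqP h|/eqP h].
    by left; split=> // _ ->.
  by right; split=> // _ ->.
- by left=> v /Xf[_]; apply.
- by right=> v /Xg[_]; apply.
Qed.

End Closed.

Section CurveMeetsPlanes.
Variable K : numClosedFieldType.
Implicit Types (X : set 'rV[K]_4).

Lemma perm_two_points n (i j : 'I_n.+2) : i != j ->
  exists s : 'S_n.+2, s ord0 = i /\ s (lift ord0 ord0) = j.
Proof.
move=> ij; exists (tperm (lift ord0 ord0) (tperm ord0 i j) * tperm ord0 i)%g.
rewrite !permM tpermL tpermK; split=> //.
rewrite (@tpermD _ _ _ ord0) ?tpermL //.
by apply: contraNneq ij => h; rewrite -(tpermK ord0 i j) h tpermL.
Qed.

(** Move coordinates [i] and [j] to the front and project twice. The image in the projective line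
    stays away from the point at infinity, so it satisfies a binary form [g] that is nonzero there;
    the ratios are roots of the dehomogenized [g]. *)
Lemma separated_coordinates X i : zariski_closed X ->
  (forall v, X v -> v 0 i != 0) -> forall j, i != j ->
  exists s : seq K, forall v, X v -> v 0 j / v 0 i \in s.
Proof.
move=> Xc Xi j ij; have [s [s0 s1]] := perm_two_points ij.
pose Y := [set col_perm s v | v in X].
have Ycone v c : Y v -> c != 0 -> Y (c *: v).
  move=> [w Xw <-] c0; exists (c *: w); first exact: zariski_closed_scale.
  by apply/rowP => k; rewrite !mxE.
have Ysep : separated_from_infinity Y.
  move=> a a0 a00; pose b := col_perm s^-1 a.
  have ba : col_perm s b = a by rewrite -col_permM mulgV col_perm1.
  have b0 : b != 0.
    by apply: contraNneq a0 => b0; rewrite -ba b0; apply/eqP/rowP => k; rewrite !mxE.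
  have bX : ~ X b by move=> /Xi; rewrite mxE -s0 permK a00 eqxx.
  case: Xc bX Xi => S Sform XE; rewrite XE => bX _.
  have [f Sf fb] : exists2 f, S f & evalv f b != 0.
    apply: contrapT => h; apply: bX; split=> // f Sf; apply/eqP/negPn/negP => fb.
    by apply: h; exists f.
  have [d hf] := Sform f Sf.
  exists d, (subst (perm_mx s) f); split; first exact: subst_homog.
    move=> _ [v Xv <-]; rewrite evalv_subst -[s in perm_mx s]invgK -col_permE.
    by rewrite -col_permM mulVg col_perm1; move: Xv; rewrite XE => -[_]; apply.
  by rewrite evalv_subst -[s in perm_mx s]invgK -col_permE.
have Y1cone v c : [set drop_last w | w in Y] v -> c != 0 ->
    [set drop_last w | w in Y] (c *: v).
  move=> [w Yw <-] c0; exists (c *: w); first exact: Ycone.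
  by apply/rowP => k; rewrite !mxE.
have sep := separated_drop_last Y1cone (separated_drop_last Ycone Ysep).
pose one : 'rV[K]_1 := const_mx 1.
(* On the projective line [append 0 1] is the only point at infinity. *)
have [||d [g [hg gY g0]]] := sep (append 0 1).
- by apply/eqP => /rowP/(_ ord_max)/eqP; rewrite append_max mxE oner_eq0.
- rewrite (_ : ord0 = widen_ord (leqnSn 1) ord0); last exact: val_inj.
  by rewrite append_widen mxE.
have [c c0 lc] := lead_coef_muni hg g0.
pose P := map_poly (meval (fun i => one 0 i)) (muni g).
have P0 : P != 0.
  by rewrite -lead_coef_eq0 /P lead_coef_map_eq lc /= mevalC.
have [r rE] := closed_field_poly_normal P.
exists r => v Xv; rewrite -root_prod_XsubC.
rewrite -(rootZ _ _ (a := lead_coef P)) ?lead_coef_eq0 //.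
rewrite -rE /root -evalv_append.
have vi := Xi v Xv.
suff -> : append one (v 0 j / v 0 i) =
    (v 0 i)^-1 *: drop_last (drop_last (col_perm s v)).
  rewrite (evalv_homogZ _ _ hg) gY ?mulr0 //.
  exists (drop_last (col_perm s v)) => //.
  by exists (col_perm s v) => //; exists v.
have wi k : (widen_ord (leqnSn 3) (widen_ord (leqnSn 2) k)) =
   if k == 0 then ord0 else lift ord0 ord0 :> 'I_4.
  by case: k => [[|[|]]] // ?; apply: val_inj.
apply/rowP => k; rewrite !mxE wi; case: unliftP => [l ->|->].
  by rewrite ord1 mxE /= s0 mulVf.
by rewrite /= s1 mulrC.
Qed.

(** Off the plane each ratio of coordinates takes finitely many values on [X], hence a single one by
    irreducibility. Then [X] is one point, which leaves no room for [Z 0] strictly inside [Z 1]. *)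
Lemma curve_meets_coord_plane X i : irreducible_curve X ->
  exists2 v, X v & v 0 i = 0.
Proof.
move=> [Xirr [[Z [Zirr Zlt]] _]]; apply: contrapT => Xi.
have Xc : zariski_closed X by case: Xirr.
have {}Xi v : X v -> v 0 i != 0.
  by move=> Xv; apply/eqP => vi; apply: Xi; exists v.
have prop j : exists c, forall v, X v -> v 0 j = c * v 0 i.
  have [->|ij] := eqVneq i j; first by exists 1 => v _; rewrite mul1r.
  have [s hs] := separated_coordinates Xc Xi ij.
  pose lin c : {mpoly K[4]} := 'X_j - c *: 'X_i.
  have linE c v : evalv (lin c) v = v 0 j - c * v 0 i.
    by rewrite /evalv mevalB mevalZ !mevalXU.
  have lin_form c : form (lin c).
    by exists 1%N; apply: rpredB; rewrite ?rpredZ // dhomogX /= mdeg1.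
  have : forall v, X v -> evalv (\prod_(c <- s) lin c) v = 0.
    move=> v Xv; rewrite (big_rem _ (hs v Xv)) /= evalvM linE.
    by rewrite divfK ?Xi // subrr mul0r.
  elim: s {hs} => [|c s IH] h.
    have [_ [v Xv] _] := Xirr; have := h v Xv.
    by rewrite big_nil /evalv meval1 => /eqP; rewrite oner_eq0.
  have [||v Xv|h'|//] := irreducible_closed_prime (f := lin c)
    (g := \prod_(c <- s) lin c) Xirr.
  - exact: lin_form.
  - elim/big_ind: _ => //; last exact: form_mul.
    by exists 0%N; apply: dhomog1.
  - by rewrite -evalvM; have := h v Xv; rewrite big_cons.
  - by exists c => v /h'; rewrite linE => /eqP; rewrite subr_eq0 => /eqP.
have [c hc] := choice prop.
have [[Z0c [v Zv] _] Z0X] := Zirr 0%N isT.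
have [_ Z1X] := Zirr 1%N isT.
have [_ []] := Zlt 0%N isT.
move=> w /Z1X Xw.
have Xv := Z0X v Zv.
have -> : w = (w 0 i / v 0 i) *: v.
  apply/rowP => j; rewrite mxE (hc j w Xw) (hc j v Xv).
  by rewrite mulrCA -mulrA mulVf ?Xi // mulr1.
by apply: zariski_closed_scale => //; rewrite mulf_neq0 ?invr_eq0 ?Xi.
Qed.
End CurveMeetsPlanes.

(** * The Hadamard map *)

Section Degree.
Variable K : fieldType.
Implicit Types (X W : set 'rV[K]_4) (f g : {mpoly K[4]}) (v : 'rV[K]_4).

Lemma homog_msizeE d g : g != 0 -> g \is d.-homog -> msize g = d.+1.
Proof.
move=> g0 hg; rewrite -(dhomog_uniq g0 (dhomog_msize hg) hg).
exact: (mpolySpred mdeg).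
Qed.

(** A nonzero multiple of the equation of [W] has degree at least [d]. *)
Lemma low_degree_form W d e g : surface_degree W d ->
  g \is e.-homog -> vanishing_ideal W g -> (e < d)%N -> g = 0.
Proof.
move=> [f [f0 hf fW]] hg /fW[h gE] ed; apply/eqP; apply: contraLR ed => g0.
have h0 : h != 0 by apply: contraNneq g0 => h0; rewrite gE h0 mul0r.
have := homog_msizeE g0 hg; rewrite gE msizeM // (homog_msizeE f0 hf) addnS /=.
move=> E; rewrite -leqNgt -ltnS -E -[X in (X <= _)%N]add1n leq_add2r.
by rewrite lt0n msize_poly_eq0.
Qed.

Lemma vanishing_ideal_closure X g :
  form g -> vanishing_ideal X g -> vanishing_ideal (zariski_closure X) g.
Proof. by move=> hg gX v [_]; apply. Qed.

End Degree.

Section Hadamard.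
Variable K : numClosedFieldType.
Implicit Types (L C : set 'rV[K]_4) (p q v : 'rV[K]_4).

Lemma hmulDl s t p p' q :
  hmul (s *: p + t *: p') q = s *: hmul p q + t *: hmul p' q.
Proof. by apply/rowP => i; rewrite !mxE mulrDl !mulrA. Qed.

Lemma mem_hadamard L C p q : L p -> C q -> hmul p q != 0 ->
  hadamard L C (hmul p q).
Proof. by move=> Lp Cq pq; split=> // g [_]; apply; exists p, q. Qed.

Lemma line_neq0 L p : is_line L -> L p -> p != 0.
Proof. by move=> [U _ ->] []. Qed.

Lemma line_comb L p p' s t : is_line L -> L p -> L p' ->
  s *: p + t *: p' != 0 -> L (s *: p + t *: p').
Proof.
by move=> [U _ ->] [_ Up] [_ Up'] n0; split; rewrite // rpredD // rpredZ.
Qed.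

(** Restriction to a fibre of the first projection gives a form on the second factor, to which the
    irreducibility of [C] applies. *)
Lemma evalv_row_mx_homog a b (f : {mpoly K[4 + 4]}) p : bihomog a b f ->
  exists2 g : {mpoly K[4]}, g \is b.-homog
    & forall q, evalv g q = evalv f (row_mx p q).
Proof.
move=> hf; pose lq := [tuple match split i with
  | inl k => (p 0 k)%:MP | inr k => 'X_k end | i < 4 + 4]
    : _.-tuple {mpoly K[4]}.
exists (f \mPo lq) => [|q].
  rewrite comp_mpolyEX big_seq; apply: rpred_sum => m /hf[_ <-].
  apply: rpredZ; rewrite comp_mpolyX big_split_ord /=.
  apply: (dhomogM (d := 0%N)).
    elim/big_ind: _ => [|f1 f2 h1 h2|j _]; first exact: dhomog1.
      exact: (dhomogM h1 h2).
    rewrite tnth_mktuple (unsplitK (inl j)); apply: (dhomogMn (d := 0%N)).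
    by rewrite -alg_mpolyC; apply/rpredZ/dhomog1.
  elim/big_ind2: _ => [|f1 k1 f2 k2|j _]; [exact: dhomog1|exact: dhomogM|].
  rewrite tnth_mktuple (unsplitK (inr j)).
  have := dhomogMn (m (rshift 4 j)) (_ : ('X_j : {mpoly K[4]}) \is 1.-homog).
  by rewrite mul1n; apply; rewrite dhomogX /= mdeg1.
rewrite /evalv comp_mpoly_meval; apply: meval_eq => i; rewrite tnth_mktuple !mxE.
by case: (split i) => k; rewrite ?mevalC ?mevalXU.
Qed.

(* At a base point [(p0, q0)] an extension [F] of the Hadamard map vanishes: its
   coordinates in the support of [q0] vanish on [{p0} x C], the other ones on
   [L x {q0}]. *)
Lemma hadamard_morphism_defined L C : is_line L -> irreducible_closed C ->
  (forall i, exists2 p, L p & p 0 i != 0) ->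
  (forall i, exists2 q, C q & q 0 i != 0) ->
  hadamard_map_is_morphism L C ->
  forall p q, L p -> C q -> hmul p q != 0.
Proof.
move=> hL hC Li Ci hmor p0 q0 Lp0 Cq0; apply/negP => /eqP pq0.
have pq i : p0 0 i * q0 0 i = 0.
  by have := congr1 (fun v : 'rV_4 => v 0 i) pq0; rewrite !mxE.
have [a [b [F [hF /eqP F0 FE]]]] := hmor p0 q0 Lp0 Cq0.
(* Where the product is defined, [F] is either zero or proportional to it. *)
have Fk p q k : L p -> C q -> hmul p q != 0 -> p 0 k * q 0 k = 0 ->
    evalv (F k) (row_mx p q) = 0.
  move=> Lp Cq n0 pqk.
  have Ek : eval2 F p q 0 k = evalv (F k) (row_mx p q) by rewrite mxE.
  have [E0|E0] := eqVneq (eval2 F p q) 0; first by rewrite -Ek E0 mxE.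
  by have [c _ Ec] := FE p q Lp Cq n0 E0; rewrite -Ek Ec !mxE pqk mulr0.
have [j p0j] : exists j, p0 0 j != 0.
  have := line_neq0 hL Lp0; apply: contra_neqP => /forallNP h.
  by apply/rowP => j; rewrite mxE; apply/eqP/negPn/negP/h.
have [l q0l] : exists l, q0 0 l != 0.
  have := zariski_closed_neq0 (let: And3 h _ _ := hC in h) Cq0.
  apply: contra_neqP => /forallNP h.
  by apply/rowP => i; rewrite mxE; apply/eqP/negPn/negP/h.
apply: F0; apply/rowP => k; rewrite [RHS]mxE [LHS]mxE.
have [q0k|q0k] := eqVneq (q0 0 k) 0.
  have [p1 Lp1 p1l] := Li l.
  have p0l : p0 0 l = 0.
    by apply/eqP; have /eqP := pq l; rewrite mulf_eq0 (negbTE q0l) orbF.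
  (* Approach [p0] along [L] through [p0 + t *: p1]: coordinate [l] makes the product with [q0]
     nonzero for [t != 0], and its coordinate [k] is always 0. *)
  apply: (evalv_limit (w := row_mx p1 0)) => t t0.
  rewrite scale_row_mx scaler0 add_row_mx addr0.
  have ptl : (p0 + t *: p1) 0 l != 0 by rewrite !mxE p0l add0r mulf_neq0.
  have pt0 : p0 + t *: p1 != 0 by apply: contraNneq ptl => ->; rewrite mxE.
  apply: Fk => //.
  - by have := line_comb (s := 1) (t := t) hL Lp0 Lp1; rewrite scale1r; apply.
  - apply: contraNneq ptl => /rowP/(_ l)/eqP.
    rewrite [X in X == _]mxE [X in _ == X]mxE mulf_eq0 (negbTE q0l) orbF.
    by move=> /eqP->.
  - by rewrite q0k mulr0.
have p0k : p0 0 k = 0.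
  by apply/eqP; have /eqP := pq k; rewrite mulf_eq0 (negbTE q0k) orbF.
have [g hg gE] := evalv_row_mx_homog p0 (hF k).
have [||q Cq|h|h] := irreducible_closed_prime (f := g) (g := 'X_j) hC.
- by exists b.
- exact: form_X.
- rewrite evalvX gE; have [->|qj] := eqVneq (q 0 j) 0; first by rewrite mulr0.
  rewrite Fk ?mul0r ?p0k ?mul0r //.
  apply: contraNneq (mulf_neq0 p0j qj) => /rowP/(_ j).
  by rewrite mxE [RHS]mxE => ->.
- by rewrite -gE h.
- by have [q Cq] := Ci j; have := h q Cq; rewrite evalvX => ->; rewrite eqxx.
Qed.

End Hadamard.

(** * Hyperplanes and binary forms *)

Section Hyperplanes.
Variables (K : fieldType) (n : nat).
Implicit Types (a : 'rV[K]_n) (u v w x : 'rV[K]_n).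

Definition hyperplane a : {vspace 'rV[K]_n} :=
  lker (linfun (mulmxr a^T : 'rV[K]_n -> 'rV[K]_1)).

Lemma mem_hyperplane a x : (x \in hyperplane a) = (\sum_j a 0 j * x 0 j == 0).
Proof.
rewrite memv_ker lfunE /=; apply/eqP/eqP => [/rowP/(_ 0)|h].
  by rewrite !mxE => h; rewrite -[RHS]h; apply: eq_bigr => j _; rewrite mxE mulrC.
apply/rowP => k; rewrite !mxE -[RHS]h.
by apply: eq_bigr => j _; rewrite mxE ord1 mulrC.
Qed.

Lemma dim_hyperplane a : a != 0 -> (\dim (hyperplane a)).+1 = n.
Proof.
move=> a0; set f := linfun (mulmxr a^T : 'rV[K]_n -> 'rV[K]_1).
have := limg_ker_dim f fullv; rewrite capfv dimvf /dim /= mul1n => E.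
have le1 : (\dim (limg f) <= 1)%N by have := dimvS (subvf (limg f)); rewrite dimvf.
have [j aj] : exists j, a 0 j != 0 by apply/rV0Pn.
have ge1 : (0 < \dim (limg f))%N.
  rewrite lt0n dimv_eq0; apply: contraNneq aj => f0.
  have : f (delta_mx 0 j) \in limg f by apply: memv_img; apply: memvf.
  rewrite f0 memv0 lfunE /= => /eqP/rowP/(_ 0).
  by rewrite -rowE !mxE => ->.
have d1 : \dim (limg f) = 1%N by apply/eqP; rewrite eqn_leq le1.
by rewrite -[RHS]E d1 addn1.
Qed.

Lemma free2P u w :
  reflect (forall s t, s *: u + t *: w = 0 -> s = 0 /\ t = 0) (free [:: u; w]).
Proof.
rewrite free_cons seq1_free span_seq1; apply: (iffP andP) => [[uw w0] s t E|h].
  have s0 : s = 0.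
    apply/eqP; apply: contraNT uw => s0; apply/vlineP; exists (- (t / s)).
    rewrite scaleNr; apply/eqP; rewrite -addr_eq0 -(inj_eq (scalerI s0)) scaler0.
    by rewrite scalerDr scalerA mulrC divfK // E.
  split=> //; move: E => /eqP; rewrite s0 scale0r add0r scaler_eq0 (negbTE w0) orbF.
  by move/eqP.
split.
  apply/negP => /vlineP[k uE]; have [|/eqP] := h 1 (- k).
    by rewrite scale1r uE scaleNr subrr.
  by rewrite oner_eq0.
apply/eqP => w0; have [|_ /eqP] := h 0 1; first by rewrite w0 scaler0 scale0r addr0.
by rewrite oner_eq0.
Qed.

Lemma hyperplane_span a (X : seq 'rV[K]_n) : a != 0 -> n = (size X).+1 ->
  free X -> {subset X <= hyperplane a} -> hyperplane a = <<X>>%VS.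
Proof.
move=> a0 nX frX sub; apply/eqP; rewrite eq_sym eqEdim; apply/andP; split.
  exact/span_subvP.
by rewrite -ltnS (dim_hyperplane a0) (eqP frX) -nX.
Qed.

End Hyperplanes.

Section BinaryForms.
Variables (K : numClosedFieldType) (n : nat).
Implicit Types (f g : {mpoly K[n]}) (u v w : 'rV[K]_n).

(** Without a zero, [g] would be a nonzero constant on each of the two affine charts of the line.
    The constants agree at [u + w], and comparing them at [2 u + w] gives [c = 2 ^ e c]. *)
Lemma binary_form_zero e g u w : (0 < e)%N -> g \is e.-homog ->
  exists s t, ((s != 0) || (t != 0)) /\ evalv g (s *: u + t *: w) = 0.
Proof.
move=> e0 hg.
have root_or_const x y : (exists t, evalv g (x + t *: y) = 0) \/
    exists2 c, c != 0 & forall t, evalv g (x + t *: y) = c.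
  have [s1|/closed_rootP[t /rootP gt]] := eqVneq (size (line_poly g x y)) 1%N.
    right; move/eqP: s1 => /size_poly1P[c c0 lc]; exists c => // t.
    by rewrite -line_polyE lc hornerC.
  by left; exists t; rewrite -line_polyE.
have [[t gt]|[c c0 gc]] := root_or_const u w.
  by exists 1, t; rewrite oner_neq0 scale1r.
have [[s gs]|[c' c'0 gc']] := root_or_const w u.
  by exists s, 1; rewrite oner_neq0 orbT scale1r addrC.
have cc : c = c' by rewrite -(gc 1) -(gc' 1) !scale1r addrC.
have n2 : (2%:R : K) != 0 by rewrite pnatr_eq0.
have : c = 2%:R ^+ e * c.
  rewrite {1}cc -(gc' 2%:R) -(gc (2%:R)^-1) -(evalv_homogZ _ _ hg).
  by rewrite scalerDr scalerA mulfV // scale1r addrC.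
move=> /eqP; rewrite -{1}[c]mul1r -subr_eq0 -mulrBl mulf_eq0 (negbTE c0) orbF.
rewrite subr_eq0 eq_sym => /eqP E.
have : (1 : K) < 2%:R ^+ e by rewrite exprn_egt1 ?ltr1n // -lt0n.
by rewrite E Order.POrderTheory.ltxx.
Qed.

(** One of the restrictions to the chart [u + t *: w] is the zero polynomial. The point [w] is at
    infinity in this chart and is reached by homogeneity and a limit. *)
Lemma binary_form_prime e f g u w : g \is e.-homog ->
  (forall s t, evalv f (s *: u + t *: w) * evalv g (s *: u + t *: w) = 0) ->
  evalv f u = 0 \/ evalv g w = 0.
Proof.
move=> hg fg0.
have : line_poly f u w * line_poly g u w = 0.
  apply: poly_eq0_punctured => t _.
  by rewrite hornerM !line_polyE; have := fg0 1 t; rewrite scale1r.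
move=> /eqP; rewrite mulf_eq0 => /orP[/eqP l0|/eqP l0].
  by left; have := line_polyE f u w 0; rewrite l0 horner0 scale0r addr0.
right; apply: (evalv_limit (w := u)) => t t0.
have -> : w + t *: u = t *: (u + t^-1 *: w).
  by rewrite scalerDr scalerA mulfV // scale1r addrC.
by rewrite (evalv_homogZ _ _ hg) -line_polyE l0 horner0 mulr0.
Qed.

End BinaryForms.

(** * Division by a linear form *)

Section Division.
Variables (K : fieldType) (n : nat).
Implicit Types (f g h : {mpoly K[n]}) (a : 'rV[K]_n) (M : 'M[K]_n).

Lemma substM M f g : subst M (f * g) = subst M f * subst M g.
Proof. exact: rmorphM. Qed.

(** Modulo [linform a] the substitution fixes every variable, hence every polynomial. *)
Lemma dvd_sub_subst a M d f :
  (forall i, exists c, 'X_i - subst M 'X_i = c *: linform a) ->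
  f \is d.+1.-homog ->
  exists2 h, h \is d.-homog & f - subst M f = linform a * h.
Proof.
move=> XM hf.
(* The monomial 1 has quotient 0, while a quotient in degree [e'.+1] has degree [e']; the match
   keeps both cases in one induction. *)
have mono e m : mdeg m = e -> exists2 h,
    'X_[m] - subst M 'X_[m] = linform a * h
    & if e is e'.+1 then h \is e'.-homog else h = 0.
  elim: e m => [|e IH] m hm.
    exists 0 => //; move/eqP: hm; rewrite mdeg_eq0 => /eqP->.
    by rewrite mulr0 mpolyX0 /subst comp_mpoly1 subrr.
  have [i mi] : exists i, m i != 0%N.
    apply/existsP; apply: contraPT hm => /existsPn m0.
    by rewrite mdegE big1 // => i _; apply/eqP; have := m0 i; rewrite negbK.
  have mE : (m - U_(i) + U_(i))%MM = m by rewrite submK // lep1mP.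
  set m' := (m - U_(i))%MM in mE.
  have hm' : mdeg m' = e by move: hm; rewrite -mE mdegD mdeg1 addn1 => -[].
  have [h hE hh] := IH m' hm'; have [c cE] := XM i.
  exists ('X_i * h + c *: subst M 'X_[m']).
    rewrite -mE mpolyXD substM mulrDr -scalerAr scalerAl -cE.
    rewrite mulrCA -hE mulrBl mulrBr [subst M _ * _ ]mulrC.
    by rewrite [_ * 'X_i]mulrC addrA subrK.
  apply: rpredD; last by apply/rpredZ/subst_homog; rewrite dhomogX /= hm'.
  case: e hh {IH hm hm'} => [->|e hh]; first by rewrite mulr0 rpred0.
  by apply: (dhomogM (d := 1%N)) => //; rewrite dhomogX /= mdeg1.
have : forall m, m \in msupp f -> exists2 h, h \is d.-homog
    & 'X_[m] - subst M 'X_[m] = linform a * h.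
  by move=> m mf; have [h hE hh] := mono _ m (dhomog_mf hf mf); exists h.
have sD g h : subst M (g + h) = subst M g + subst M h by exact: comp_mpolyD.
have sZ c g : subst M (c *: g) = c *: subst M g by exact: comp_mpolyZ.
rewrite {2 3}(mpolyE f); elim: (msupp f) => [|m s IH] hs.
  exists 0; first exact: rpred0.
  by rewrite big_nil mulr0 /subst comp_mpoly0 subrr.
have [|h hh hE] := IH; first by move=> m' m's; apply: hs; rewrite inE m's orbT.
have [h' hh' hE'] := hs m (mem_head _ _).
exists (f@_m *: h' + h); first by rewrite rpredD // rpredZ.
by rewrite big_cons sD sZ opprD addrACA hE -scalerBr hE' mulrDr scalerAr.
Qed.

End Division.

(** * Lines in the surface *)

Section LinesInSurface.
Variable K : numClosedFieldType.
Implicit Types (X W L C : set 'rV[K]_4) (u v w p q : 'rV[K]_4).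

Definition contains_line W u w :=
  forall s t, s *: u + t *: w != 0 -> W (s *: u + t *: w).

Lemma mem_hyperplane_delta i v : (v \in hyperplane (delta_mx 0 i)) = (v 0 i == 0).
Proof.
rewrite mem_hyperplane (bigD1 i) //= big1 ?addr0 => [|j ji].
  by rewrite mxE !eqxx mul1r.
by rewrite mxE eqxx (negbTE ji) mul0r.
Qed.

Lemma delta_neq0 (i : 'I_4) : delta_mx 0 i != 0 :> 'rV[K]_4.
Proof. by apply/eqP => /rowP/(_ i)/eqP; rewrite !mxE !eqxx oner_eq0. Qed.

Lemma line_not_transversal X d i u w :
  surface_degree (zariski_closure X) d -> (1 < d)%N ->
  free [:: u; w] -> u 0 i = 0 -> w 0 i = 0 ->
  contains_line (zariski_closure X) u w ->
  ~ meets_coord_plane_transversally (zariski_closure X) i.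
Proof.
set W := zariski_closure X => -[f [f0 hf fW]] d1 uw ui wi Wuw trans.
have fI : vanishing_ideal W f by apply/fW; exists 1; rewrite mul1r.
have d0 : (0 < d)%N by apply: ltn_trans d1.
have fl s t : evalv f (s *: u + t *: w) = 0.
  have [->|n0] := eqVneq (s *: u + t *: w) 0; first exact: evalv_homog0 hf.
  exact/fI/Wuw.
pose H := hyperplane (delta_mx 0 i : 'rV[K]_4).
have [dH] := dim_hyperplane (delta_neq0 i).
have [z Hz zuw] : exists2 z, z \in H & z \notin <<[:: u; w]>>%VS.
  apply/subvPn; apply/negP => /dimvS; rewrite dH => h.
  by have := leq_trans h (dim_span _).
have zfree : free [:: z; u; w] by rewrite free_cons zuw.
have HE : H = <<[:: z; u; w]>>%VS.
  apply: hyperplane_span => //; first exact: delta_neq0.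
  move=> x; rewrite !inE mem_hyperplane_delta => /or3P[]/eqP->; rewrite ?ui ?wi //.
  by move: Hz; rewrite mem_hyperplane_delta.
pose g := \sum_j z 0 j *: mderiv j f.
have hg : g \is d.-1.-homog.
  by apply: rpred_sum => j _; apply/rpredZ/mderiv_homog.
have gE v : evalv g v = \sum_j evalv (mderiv j f) v * z 0 j.
  by rewrite evalv_sum; apply: eq_bigr => j _; rewrite /evalv mevalZ mulrC.
have [|s [t [st gst]]] := binary_form_zero u w _ hg.
  by rewrite -ltnS prednK.
set v := s *: u + t *: w in gst.
have v0 : v != 0.
  apply: contraTneq st => /(elimT (free2P u w) uw)[-> ->].
  by rewrite eqxx.
(* [grad] may be zero, when [v] is singular; [hyperplane grad] is then the whole space and the
   inclusion below still makes sense. *)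
pose grad := \row_j evalv (mderiv j f) v.
have gradE y : (y \in hyperplane grad) =
    (\sum_j evalv (mderiv j f) v * y 0 j == 0).
  by rewrite mem_hyperplane; under eq_bigr do rewrite mxE.
have subH : (H <= hyperplane grad)%VS.
  rewrite HE; apply/span_subvP => x; rewrite !inE => /or3P[]/eqP->; rewrite gradE.
  - by rewrite -gE gst.
  - apply/eqP/directional_deriv0 => e.
    by rewrite /v addrAC -scalerDl fl.
  - apply/eqP/directional_deriv0 => e.
    by rewrite /v -addrA -scalerDl fl.
have vi : v 0 i = 0 by rewrite !mxE ui wi !mulr0 addr0.
have [|[U dU TU] TE] := trans v; first by split; [exact: Wuw|].
apply: TE; rewrite TU.
suff -> : U = H.
  by apply/seteqP; split=> x [x0]; rewrite /= mem_hyperplane_delta => /eqP.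
apply/eqP; rewrite eq_sym eqEdim dH dU leqnn andbT; apply/subvP => y yH.
have [->|y0] := eqVneq y 0; first exact: mem0v.
suff : tangent_space W v y by rewrite TU => -[].
(* As [f] vanishes at [v], the differential of [k * f] there is the value of [k] times that of
   [f]. *)
split=> // h /fW[k ->]; have := subvP subH y yH; rewrite gradE => /eqP gy.
transitivity (evalv k v * \sum_j evalv (mderiv j f) v * y 0 j); last first.
  by rewrite gy mulr0.
rewrite mulr_sumr; apply: eq_bigr => j _.
by rewrite mderivM evalvD !evalvM fl mulr0 add0r mulrA.
Qed.

Lemma hyperplane_through3 u v w : exists2 a : 'rV[K]_4, a != 0
  & {subset [:: u; v; w] <= hyperplane a}.
Proof.
pose M := col_mx u (col_mx v w).
have : kermx M^T != 0.
  rewrite -mxrank_eq0 mxrank_ker -lt0n subn_gt0.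
  exact: leq_ltn_trans (rank_leq_col _) _.
move=> /rowV0Pn[a /sub_kermxP aM a0]; exists a => //.
have : M *m a^T = 0 by rewrite -[M]trmxK -trmx_mul aM trmx0.
rewrite !mul_col_mx => /eqP; rewrite !col_mx_eq0 => /and3P[/eqP au /eqP av /eqP aw].
have aE x : x *m a^T = 0 -> x \in hyperplane a.
  by move=> h; rewrite memv_ker lfunE /= h.
by move=> x; rewrite !inE => /or3P[]/eqP->; apply: aE.
Qed.

Lemma dvd_linform (a : 'rV[K]_4) d (f : {mpoly K[4]}) : a != 0 ->
  f \is d.+1.-homog -> (forall x, x \in hyperplane a -> evalv f x = 0) ->
  exists2 g : {mpoly K[4]}, g \is d.-homog
    & forall x, evalv f x = evalv (linform a) x * evalv g x.
Proof.
move=> /rV0Pn[k ak] hf fa.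
(* The projection onto [hyperplane a] along the [k]-th coordinate vector; it changes only ['X_k], by
   a multiple of [linform a], and [f] vanishes on its image. *)
pose M : 'M[K]_4 := 1%:M - (a 0 k)^-1 *: (a^T *m delta_mx 0 k).
have MX i : exists c, 'X_i - subst M 'X_i = c *: linform a.
  exists (if i == k then (a 0 k)^-1 else 0).
  rewrite /subst comp_mpolyXU -tnth_nth tnth_mktuple /linform.
  have -> : 'X_i = \sum_j (j == i)%:R *: 'X_j :> {mpoly K[4]}.
    rewrite (bigD1 i) //= big1 ?addr0 ?eqxx ?scale1r // => j ji.
    by rewrite (negbTE ji) scale0r.
  rewrite -sumrB scaler_sumr; apply: eq_bigr => j _.
  rewrite -scalerBl scalerA !mxE big_ord1 !mxE eqxx /=.
  congr (_ *: _); rewrite opprB addrC subrK.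
  by case: (i == k); rewrite ?mulr1 ?mulr0 ?mul0r.
have [g hg gE] := dvd_sub_subst MX hf; exists g => // x.
rewrite -evalvM -gE /evalv mevalB -/(evalv _ _).
rewrite -[meval _ (subst _ _)]/(evalv _ x).
rewrite evalv_subst (fa (x *m M)) ?subr0 // memv_ker lfunE /=.
rewrite -mulmxA mulmxBl mul1mx.
rewrite -scalemxAl -mulmxA -rowE (_ : row k a^T = (a 0 k)%:M).
  by rewrite mul_mx_scalar scalerA mulVf // scale1r subrr mulmx0.
by apply/rowP => j; rewrite !mxE ord1 eqxx mulr1n.
Qed.

(** [Z h] is the closed set of those [q] for which [h] vanishes on the line [L * q]. Each such line
    is irreducible, so [C] is covered by [Z f] and [Z g], and lies in one of them. *)
Lemma hadamard_prime L C d e f g : is_line L -> irreducible_closed C ->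
  (forall p q, L p -> C q -> hmul p q != 0) ->
  f \is d.-homog -> g \is e.-homog -> (0 < d)%N ->
  (forall v, hadamard L C v -> evalv f v * evalv g v = 0) ->
  vanishing_ideal (hadamard L C) f \/ vanishing_ideal (hadamard L C) g.
Proof.
move=> hL [Cc C0 Cirr] pq0 hf hg d0 fg0.
pose Z h := zero_locus [set subst (diag_mx p) h | p in L].
have hmulE p q : q *m diag_mx p = hmul p q.
  by apply/rowP => j; rewrite mul_mx_diag !mxE mulrC.
have ZE h q : C q -> (forall p, L p -> evalv h (hmul p q) = 0) -> Z h q.
  move=> Cq hq; split; first exact: zariski_closed_neq0 Cq.
  by move=> _ [p Lp <-]; rewrite evalv_subst hmulE hq.
have Zc k h : h \is k.-homog -> zariski_closed (Z h).
  move=> hh; exists [set subst (diag_mx p) h | p in L] => // _ [p _ <-].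
  by exists k; apply: subst_homog.
have Zvan k h : h \is k.-homog -> C `<=` Z h -> vanishing_ideal (hadamard L C) h.
  move=> hh CZ; apply: vanishing_ideal_closure; first by exists k.
  move=> _ [p [q [Lp /CZ[_ Zq] _ ->]]].
  by rewrite -hmulE -evalv_subst; apply: Zq; exists p.
have [||q Cq||] := Cirr (Z f) (Z g); first exact: Zc hf.
- exact: Zc hg.
- have [h|] := pselect (forall p, L p -> evalv f (hmul p q) = 0).
    by left; apply: ZE.
  move=> /existsNP[p1 /not_implyP[Lp1 /eqP fp1]].
  right; apply: ZE => // p2 Lp2.
  have [s t||//] := binary_form_prime (f := f) (u := hmul p1 q)
      (w := hmul p2 q) hg.
    rewrite -hmulDl; have [->|n0] := eqVneq (s *: p1 + t *: p2) 0.
      have -> : hmul 0 q = 0 by apply/rowP => j; rewrite !mxE mul0r.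
      by rewrite (evalv_homog0 d0 hf) mul0r.
    have Lp := line_comb hL Lp1 Lp2 n0.
    by apply/fg0/mem_hadamard => //; apply: pq0.
  by move/eqP; rewrite (negbTE fp1).
- by left; apply: Zvan hf _.
- by right; apply: Zvan hg _.
Qed.

Lemma hadamard_not_cone L C d : is_line L -> irreducible_closed C ->
  (forall p q, L p -> C q -> hmul p q != 0) ->
  surface_degree (hadamard L C) d -> (1 < d)%N ->
  (forall i, exists u w, [/\ free [:: u; w], u 0 i = 0, w 0 i = 0
    & contains_line (hadamard L C) u w]) ->
  ~ is_cone (hadamard L C).
Proof.
move=> hL hC pq0 hd d1 lines [v Wv vcone].
have [f [f0 hf fW]] := hd.
have fI : vanishing_ideal (hadamard L C) f by apply/fW; exists 1; rewrite mul1r.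
have d0 : (0 < d)%N by apply: ltn_trans d1.
have [i vi] : exists i, v 0 i != 0 by apply/rV0Pn; case: Wv.
have [u [w [uw ui wi Wuw]]] := lines i.
(* The plane spanned by the vertex and the line; [v 0 i != 0] keeps the vertex off the line. *)
have [a a0 asub] := hyperplane_through3 v u w.
have vuw : free [:: v; u; w].
  rewrite free_cons uw andbT; apply: contraNN vi.
  rewrite -mem_hyperplane_delta; apply/subvP/span_subvP => x.
  by rewrite !inE => /orP[]/eqP->; rewrite mem_hyperplane_delta ?ui ?wi.
have fa x : x \in hyperplane a -> evalv f x = 0.
  rewrite (hyperplane_span a0 _ vuw asub) //.
  rewrite span_cons span_cons span_seq1.
  move=> /memv_addP[_ /vlineP[r ->]
    [_ /memv_addP[_ /vlineP[s ->] [_ /vlineP[t ->] ->]] ->]].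
  have [->|n0] := eqVneq (r *: v + (s *: u + t *: w)) 0; first exact: evalv_homog0 hf.
  apply: fI; have [E|n1] := eqVneq (s *: u + t *: w) 0.
    move: n0; rewrite E addr0 => n0; have := vcone v Wv r 0.
    by rewrite scale0r addr0; apply.
  by have := vcone _ (Wuw _ _ n1) r 1; rewrite scale1r; apply.
have hf' : f \is d.-1.+1.-homog by rewrite prednK.
have [g hg fE] := dvd_linform a0 hf' fa.
have [x fx|gI|lI] := hadamard_prime hL hC pq0 (linform_homog a) hg isT.
- by rewrite -fE fI.
- have := low_degree_form hd (linform_homog a) gI d1.
  move: a0 => /rV0Pn[k ak] /(congr1 (fun h => evalv h (delta_mx 0 k))).
  rewrite evalv_linform (bigD1 k) //= big1 ?addr0 => [|j jk].
    by rewrite mxE !eqxx mulr1 /evalv meval0; apply/eqP.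
  by rewrite mxE eqxx (negbTE jk) mulr0.
- have g0 := low_degree_form hd hg lI; rewrite prednK // in g0.
  have f_eq0 x : evalv f x = 0 by rewrite fE g0 // /evalv meval0 mulr0.
  (* So far [f] is zero only as a function. Its partial derivatives then vanish everywhere too, and
     are zero polynomials because of their degree [d.-1]; in characteristic 0 this contradicts the
     leading term of [f]. *)
  have df j : mderiv j f = 0.
    apply: (low_degree_form hd (mderiv_homog j hf)); last by rewrite prednK.
    move=> x _; have := directional_deriv0 (f := f) (u := x) (w := delta_mx 0 j).
    rewrite (bigD1 j) //= big1 ?addr0 => [|k kj].
      by rewrite mxE !eqxx mulr1; apply.
    by rewrite mxE eqxx (negbTE kj) mulr0.
  have fm := mlead_supp f0.
  have [j mj] : exists j, mlead f j != 0%N.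
    apply/existsP; apply: contraTT d0 => /existsPn m0.
    rewrite -(dhomog_mf hf fm) /= mdegE big1 // => j _.
    by apply/eqP; have := m0 j; rewrite negbK.
  have := congr1 (mcoeff (mlead f - U_(j))) (df j).
  rewrite mcoeff_mderiv mcoeff0 submK ?lep1mP // => /eqP.
  by rewrite mulrn_eq0 /= mleadc_eq0 (negbTE f0).
Qed.

End LinesInSurface.

(** * Lines of the surface in each coordinate plane, and the conclusion *)

Section Main.
Variable K : numClosedFieldType.
Implicit Types (L C : set 'rV[K]_4).

(** Otherwise ['X_i], of degree 1, would vanish on the surface. *)
Lemma hadamard_factors_not_planar L C d i :
  surface_degree (hadamard L C) d -> (1 < d)%N ->
  (exists2 p, L p & p 0 i != 0) /\ (exists2 q, C q & q 0 i != 0).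
Proof.
move=> hd d1.
have X1 : ('X_i : {mpoly K[4]}) \is 1.-homog by rewrite dhomogX /= mdeg1.
have nI : ~ vanishing_ideal (hadamard L C) 'X_i.
  move=> /(low_degree_form hd X1)/(_ d1).
  move=> /(congr1 (fun h => evalv h (delta_mx 0 i)))/eqP.
  by rewrite evalvX /evalv meval0 mxE !eqxx oner_eq0.
have vanI : (forall p q, L p -> C q -> p 0 i * q 0 i = 0) -> False.
  move=> h; apply/nI/vanishing_ideal_closure; first exact: form_X.
  by move=> _ [p [q [Lp Cq _ ->]]]; rewrite evalvX mxE h.
split; apply: contrapT => h; apply: vanI => p q Lp Cq.
  have [->|pi] := eqVneq (p 0 i) 0; first by rewrite mul0r.
  by case: h; exists p.
have [->|qi] := eqVneq (q 0 i) 0; first by rewrite mulr0.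
by case: h; exists q.
Qed.

(** Multiplication by a point [q] of [C] in the plane is linear, and injective on the span of [L]
    because no product is zero. *)
Lemma coord_plane_contains_line L C i : is_line L -> irreducible_curve C ->
  (forall p q, L p -> C q -> hmul p q != 0) ->
  exists u w : 'rV[K]_4, [/\ free [:: u; w], u 0 i = 0, w 0 i = 0
    & contains_line (hadamard L C) u w].
Proof.
move=> hL hC pq0; have [q Cq qi] := curve_meets_coord_plane i hC.
have [a [b [/free2P ab Lab]]] : exists a b, free [:: a; b] /\
    forall s t, s *: a + t *: b != 0 -> L (s *: a + t *: b).
  have [U dU ->] := hL; have sz := size_tuple (vbasis U).
  case vU : (tval (vbasis U)) sz => [|a [|b [|]]]; rewrite /= dU // => _.
  exists a, b; split; first by rewrite -vU; apply: basis_free (vbasisP U).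
  have mU x : x \in [:: a; b] -> x \in U by rewrite -vU; apply: vbasis_mem.
  move=> s t n0; split=> //.
  by rewrite rpredD // rpredZ // mU // !inE eqxx ?orbT.
exists (hmul a q), (hmul b q); split.
- apply/free2P => s t; rewrite -hmulDl => /eqP E; apply: ab; apply/eqP.
  by apply: contraLR E => n0; apply/pq0/Cq/Lab.
- by rewrite mxE qi mulr0.
- by rewrite mxE qi mulr0.
- move=> s t; rewrite -hmulDl => n0; apply: mem_hadamard => //; apply: Lab.
  by apply: contraNneq n0 => ->; apply/eqP/rowP => j; rewrite !mxE mul0r.
Qed.

End Main.

Theorem corollary4p5 (R : realType) (L C : set 'rV[R[i]%C]_4) (d : nat)
    (hL : is_line L) (hC : irreducible_curve C)
    (hW : is_surface (hadamard L C))
    (hd : surface_degree (hadamard L C) d) (hd3 : (3 <= d)%N)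
    (hmor : hadamard_map_is_morphism L C) :
  (forall i : 'I_4, ~ meets_coord_plane_transversally (hadamard L C) i) /\
  ~ is_cone (hadamard L C).
Proof.
have d1 : (1 < d)%N by apply: leq_trans hd3.
have pq0 : forall p q, L p -> C q -> hmul p q != 0.
  apply: hadamard_morphism_defined => // [|i|i]; first by case: hC.
    by have [] := hadamard_factors_not_planar i hd d1.
  by have [] := hadamard_factors_not_planar i hd d1.
have lines i := coord_plane_contains_line i hL hC pq0.
split=> [i|].
  have [u [w [uw ui wi Wuw]]] := lines i.
  exact: line_not_transversal hd d1 uw ui wi Wuw.
by apply: hadamard_not_cone hd d1 lines => //; case: hC.
Qed.
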